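(* Let $n\ge1$. In A and B let $H>0$; in C and D let $H=(H_1,\dots,H_n)\in\mathbb{R}_+^n$. A. For all $\alpha\in(0,2]$ and $\beta>0$, the $H$-self-similar Gaussian field $Y_{\alpha,\beta}(t)=\Vert t\Vert^HX_{\alpha,\beta}(\ln t_1,\dots,\ln t_n)$, $t\in\mathbb{R}_+^n$, is long range dependent. B. For all $\alpha,\beta\in\mathbb{R}_+^n$ with $\alpha_i\in(0,2]$ and $\beta_i>0$, $1\le i\le n$, the $H$-self-similar Gaussian field $Y^{\#}_{\alpha,\beta}(t)=\Vert t\Vert^HX^{\#}_{\alpha,\beta}(\ln t_1,\dots,\ln t_n)$, $t\in\mathbb{R}_+^n$, is long range dependent. C. For all $\alpha\in(0,2]$ and $\beta>0$, the $H$-multi-self-similar Gaussian field $\mathbb{Y}_{\alpha,\beta}(t)=t_1^{H_1}\cdots t_n^{H_n}X_{\alpha,\beta}(\ln t_1,\dots,\ln t_n)$, $t\in\mathbb{R}_+^n$, is long range dependent. D. For all $\alpha,\beta\in\mathbb{R}_+^n$ with $\alpha_i\in(0,2]$ and $\beta_i>0$, $1\le i\le n$, the $H$-multi-self-similar Gaussian field $\mathbb{Y}^{\#}_{\alpha,\beta}(t)=t_1^{H_1}\cdots t_n^{H_n}X^{\#}_{\alpha,\beta}(\ln t_1,\dots,\ln t_n)$, $t\in\mathbb{R}_+^n$, is long range dependent.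
   Context: $\mathbb{R}_+$ is the set of positive reals, $\Vert\cdot\Vert$ the Euclidean norm. For scalars $\alpha\in(0,2]$, $\beta>0$, $X_{\alpha,\beta}$ is the centered stationary Gaussian field on $\mathbb{R}^n$ with covariance $(1+\Vert\tau\Vert^\alpha)^{-\beta}$. For $\alpha\in(0,2]^n$, $\beta\in(0,\infty)^n$, $X^{\#}_{\alpha,\beta}$ is the centered stationary Gaussian field on $\mathbb{R}^n$ with covariance $\prod_{i=1}^n(1+|\tau_i|^{\alpha_i})^{-\beta_i}$. Long range dependence for a non-stationary centered Gaussian field $X$ with covariance $C(t,s)=\langle X(t)X(s)\rangle$: let $R_X(t,t+\tau)=C(t,t+\tau)/\sqrt{C(t+\tau,t+\tau)C(t,t)}$ be the correlation function; $X$ is long range dependent if $\int_{\mathbb{R}_+^n}|R_X(t,t+\tau)|\,d^n\tau=\infty$ (here: for every $t\in\mathbb{R}_+^n$). A field $Y$ on $\mathbb{R}_+^n$ is $H$-self-similar ($H>0$) if $\{Y(ct)\}$ and $\{c^HY(t)\}$ have the same finite-dimensional distributions for all $c>0$; it is $H$-multi-self-similar ($H\in\mathbb{R}_+^n$) if $\{Y(c_1t_1,\dots,c_nt_n)\}$ and $\{c_1^{H_1}\cdots c_n^{H_n}Y(t)\}$ have the same finite-dimensional distributions for all $c\in\mathbb{R}_+^n$. *)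

(* Defs.v *)
From HB Require Import structures.
From mathcomp Require Import all_boot all_order all_algebra.
From mathcomp Require Import all_classical all_reals all_analysis.

Set Implicit Arguments.
Unset Strict Implicit.
Unset Printing Implicit Defensive.

Import Order.TTheory GRing.Theory Num.Theory.
Import numFieldNormedType.Exports.

Local Open Scope classical_set_scope.
Local Open Scope ring_scope.

Section LebesgueTuple.
Context {R : realType}.

Definition tuple_cons n (p : R * n.-tuple R) : n.+1.-tuple R :=
  [tuple of p.1 :: p.2].

Lemma measurable_tuple_cons n : measurable_fun setT (@tuple_cons n).
Proof. exact: measurable_cons. Qed.

(* n-dimensional Lebesgue measure; lebesgue_tuple_box below is the property that
   characterizes it. *)
Fixpoint lebesgue_tuple n : {measure set (n.-tuple R) -> \bar R} :=
  match n with
  | 0 => \d_([tuple] : 0.-tuple R)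
  | m.+1 =>
    (* pushforward of the product measure, with its measure structure *)
    measure_function_pushforward__canonical__measure_function_Measure
      (lebesgue_measure \x^ lebesgue_tuple m)%E (@measurable_tuple_cons m)
  end.

Lemma lebesgue_tuple_box n (A : 'I_n -> set R) :
  (forall i, measurable (A i)) ->
  lebesgue_tuple n [set x | forall i, A i (tnth x i)] =
  (\prod_(i < n) lebesgue_measure (A i))%E.
Proof.
elim: n A => [|n IHn] A mA.
  rewrite big_ord0 /= diracE mem_set//; by case.
rewrite big_ord_recl -IHn => [|i]; last exact: mA.
rewrite /= /pushforward.
rewrite -product_measure2E//; [|exact: mA|]; last first.
  rewrite [X in measurable X](_ : _ = \bigcap_(i in [set: 'I_n])
    ((@tnth n R)^~ i @^-1` A (lift ord0 i))); last first.
    by apply/seteqP; split=> x /= h i; [move=> _|]; exact: h.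
  apply: fin_bigcap_measurable => // i _.
  by rewrite -[X in measurable X]setTI; exact: measurable_tnth.
congr (product_measure2 _ _); apply/seteqP; split=> -[y x] /=.
  move=> h; split; first by have := h ord0; rewrite tnth0.
  by move=> i; have := h (lift ord0 i); rewrite tnthS.
move=> [h0 h] i; case: (unliftP ord0 i) => [j|] ->; first by rewrite tnthS.
by rewrite tnth0.
Qed.
End LebesgueTuple.

Section Vectors.
Context {R : realType} {n : nat}.
Implicit Types s t c : n.-tuple R.

Definition orthant : set (n.-tuple R) := [set t | forall i, 0 < tnth t i].

Definition tuple_add s t : n.-tuple R := [tuple tnth s i + tnth t i | i < n].

Definition tuple_mul c t : n.-tuple R := [tuple tnth c i * tnth t i | i < n].

Definition tuple_scale (a : R) t : n.-tuple R := [tuple a * tnth t i | i < n].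

Definition tuple_ln t : n.-tuple R := [tuple ln (tnth t i) | i < n].

Definition enorm t : R := Num.sqrt (\sum_(i < n) tnth t i ^+ 2).

Definition monomial t (H : n.-tuple R) : R :=
  \prod_(i < n) tnth t i `^ tnth H i.

End Vectors.
Arguments orthant : clear implicits.

Section RandomFields.
Context {R : realType} {d : measure_display} {T : measurableType d}.
Variable P : probability T R.

(* A field on a subset D of R^n is also represented by a function on R^n; the
   notions below only look at its values on D. *)
Definition random_field n := n.-tuple R -> {RV P >-> R}.

Context {n : nat}.
Implicit Types (X Y : random_field n) (D : set (n.-tuple R)).

(* Degenerate laws (standard deviation s = 0) are Gaussian; normal_prob m 0 is
   not the Dirac mass at m. *)
Definition gaussian_law (mu : set R -> \bar R) : Prop :=
  exists m s : R, 0 <= s /\ forall A, measurable A ->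
    mu A = if s == 0 then \d_m A else normal_prob m s A.

Definition gaussian_field D X : Prop :=
  forall k (ts : k.-tuple (n.-tuple R)) (a : k.-tuple R),
    (forall j, D (tnth ts j)) ->
    gaussian_law
      (pushforward P (fun w => \sum_(j < k) tnth a j * X (tnth ts j) w)).

Definition centered D X : Prop := forall t, D t -> 'E_P[X t]%E = 0%E.

Definition joint_law X k (ts : k.-tuple (n.-tuple R)) :
    set (k.-tuple R) -> \bar R :=
  pushforward P (fun w => [tuple X (tnth ts j) w | j < k]).

Definition same_fdd D X Y : Prop :=
  forall k (ts : k.-tuple (n.-tuple R)), (forall j, D (tnth ts j)) ->
    forall A, measurable A -> joint_law X ts A = joint_law Y ts A.

Definition stationary X : Prop :=
  forall h, same_fdd setT (fun t => X (tuple_add t h)) X.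

Definition cov X s t : \bar R := 'E_P[X s \* X t]%E.

Definition corr X s t : R :=
  fine (cov X s t) / Num.sqrt (fine (cov X t t) * fine (cov X s s)).

Definition stationary_gaussian_field (rho : n.-tuple R -> R) X : Prop :=
  [/\ gaussian_field setT X, centered setT X, stationary X &
      forall t tau, cov X t (tuple_add t tau) = (rho tau)%:E].

Definition self_similar (H : R) Y : Prop :=
  forall a : R, 0 < a ->
    same_fdd (orthant R n) (fun t => Y (tuple_scale a t))
                           (fun t => a `^ H *: Y t).

Definition multi_self_similar (H : n.-tuple R) Y : Prop :=
  forall c, orthant R n c ->
    same_fdd (orthant R n) (fun t => Y (tuple_mul c t))
                           (fun t => monomial c H *: Y t).

Definition long_range_dependent Y : Prop :=
  forall t, orthant R n t ->
    (\int[lebesgue_tuple n]_(tau in orthant R n)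
       (`|corr Y t (tuple_add t tau)|)%:E = +oo)%E.

Definition norm_lamperti (H : R) X : random_field n :=
  fun t => enorm t `^ H *: X (tuple_ln t).

Definition monomial_lamperti (H : n.-tuple R) X : random_field n :=
  fun t => monomial t H *: X (tuple_ln t).

End RandomFields.

Definition cauchy_cov (R : realType) n (alpha beta : R) (tau : n.-tuple R) : R :=
  (1 + enorm tau `^ alpha) `^ (- beta).

Definition cauchy_prod_cov (R : realType) n (alpha beta tau : n.-tuple R) : R :=
  \prod_(i < n) (1 + `|tnth tau i| `^ tnth alpha i) `^ (- tnth beta i).

(* Main.v *)
(** The factors ||t||^H and t^H cancel in the correlation, so that the correlation
    of Y between t and t + tau is rho(ln(t + tau) - ln t), where rho is the
    covariance of X.  As rho decays only like a power, it is at least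
    C e^(-n N / 2) on the cube [0, N]^n, whereas the tau for which
    ln(t + tau) - ln t lies in that cube have a volume of order e^(n N). *)
Require Import Defs.
From mathcomp Require Import all_boot all_order all_algebra.
From mathcomp Require Import all_classical all_reals all_analysis.
From mathcomp Require Import measurable_realfun ring lra.

Set Implicit Arguments.
Unset Strict Implicit.
Unset Printing Implicit Defensive.

Import Order.TTheory GRing.Theory Num.Theory.

Local Open Scope classical_set_scope.
Local Open Scope ring_scope.

(** * Lower bounds for integrals and scaling of expectations *)

Section IntegralLowerBound.
Import HBNNSimple.

(** Both integrals are suprema over simple functions, and a simple function below [c] on [A] and
    below 0 elsewhere is below [f] on [D]. Arguing with suprema covers an [f] of unknown
    measurability, such as the correlation for an arbitrary [rho]. *)
Lemma ge0_integral_ge_cst d (T : measurableType d) (R : realType)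
    (mu : {measure set T -> \bar R}) (A D : set T) (f : T -> \bar R) (c : R) :
  measurable A -> A `<=` D -> 0 <= c ->
  (forall x, D x -> (0 <= f x)%E) -> (forall x, A x -> (c%:E <= f x)%E) ->
  (c%:E * mu A <= \int[mu]_(x in D) f x)%E.
Proof.
move=> mA AD c0 f0 cf.
rewrite -[leLHS](integral_cst mu mA) !ge0_integralE//.
apply: ereal_sup_le => _ [h hc <-].
exists h => // x; apply: le_trans (hc x) _; rewrite /patch.
case: ifPn => [/set_mem Ax|_]; first by rewrite mem_set ?cf//; exact: AD.
by case: ifPn => // /set_mem; exact: f0.
Qed.
End IntegralLowerBound.

(* If both parts of f have infinite integral, the integral of f is
   +oo - +oo = -oo, hence finiteness yields integrability. *)
Lemma fin_num_integrable d (T : measurableType d) (R : realType)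
    (mu : {measure set T -> \bar R}) (D : set T) (f : T -> \bar R) :
  measurable D -> measurable_fun D f ->
  (\int[mu]_(x in D) f x)%E \is a fin_num -> mu.-integrable D f.
Proof.
move=> mD mf If; apply/integrableP; split => //.
rewrite -[X in integral _ _ X]/(abse \o f) fune_abse.
rewrite ge0_integralD//; [|exact: measurable_funepos|exact: measurable_funeneg].
have p0 : (0 <= \int[mu]_(x in D) f^\+ x)%E by exact: integral_ge0.
have n0 : (0 <= \int[mu]_(x in D) f^\- x)%E by exact: integral_ge0.
move: If; rewrite integralE fin_numB => /andP[pf nf].
by rewrite lte_add_pinfty// -ge0_fin_numE.
Qed.

(** Assumptions on the fields only give values of expectations; finiteness of such a value yields
    the integrability that linearity requires. *)
Lemma fin_num_expectationZ d (T : measurableType d) (R : realType)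
    (P : probability T R) (a : R) (X : {RV P >-> R}) :
  'E_P[X]%E \is a fin_num -> 'E_P[a *: X]%E = (a%:E * 'E_P[X])%E.
Proof.
rewrite unlock => EX; rewrite -integralZl//.
by apply: fin_num_integrable => //; exact/measurable_EFinP.
Qed.

(** * Lamperti transforms with a general weight [g] *)

Section Lamperti.
Context (R : realType) (d : measure_display) (T : measurableType d).
Context (P : probability T R) (n : nat).
Variables (X : random_field P n) (g : n.-tuple R -> R).
Let Y : random_field P n := fun t => g t *: X (tuple_ln t).

Lemma lamperti_gaussian : gaussian_field setT X -> gaussian_field (orthant R n) Y.
Proof.
move=> gX k ts a _.
have := gX k [tuple tuple_ln (tnth ts j) | j < k]
  [tuple tnth a j * g (tnth ts j) | j < k] (fun=> I).
congr (gaussian_law (pushforward P _)); apply/funext => w.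
by apply: eq_bigr => j _; rewrite !tnth_mktuple mulrA.
Qed.

Lemma lamperti_centered : centered setT X -> centered (orthant R n) Y.
Proof.
by move=> cX t _; rewrite fin_num_expectationZ cX// mule0.
Qed.

(** As ln(c t) = ln t + ln c, a dilation of [Y] translates the argument of [X], and stationarity
    absorbs the translation. Only the factor [k] of the weight remains. *)
Lemma lamperti_same_fdd (c : n.-tuple R) (k : R) :
  stationary X -> orthant R n c ->
  (forall t, orthant R n t -> g (tuple_mul c t) = k * g t) ->
  same_fdd (orthant R n) (fun t => Y (tuple_mul c t)) (fun t => k *: Y t).
Proof.
move=> sX c0 gc m ts ts0 A mA.
pose b : m.-tuple R := [tuple k * g (tnth ts j) | j < m].
pose f (v : m.-tuple R) := tuple_mul b v.
have mf : measurable_fun setT f.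
  apply/measurable_fun_tnthP => j.
  rewrite [X in measurable_fun _ X](_ : _ = fun v => tnth b j * tnth v j).
    by apply: measurable_funM; [exact: measurable_cst|exact: measurable_tnth].
  by apply/funext => v /=; rewrite tnth_mktuple.
have mfA : measurable (f @^-1` A) by rewrite -[_ @^-1` _]setTI; exact: mf.
have := sX (tuple_ln c) m [tuple tuple_ln (tnth ts j) | j < m] (fun=> I) _ mfA.
rewrite /joint_law /pushforward => E.
transitivity (P ((fun w => [tuple X (tuple_add (tnth [tuple tuple_ln (tnth ts j0)
   | j0 < m] j) (tuple_ln c)) w | j < m]) @^-1` (f @^-1` A))).
  rewrite -comp_preimage; congr (P (_ @^-1` A)); apply/funext => w /=.
  apply: eq_from_tnth => j; rewrite !tnth_mktuple /= gc//; congr (_ * X _ w).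
  apply: eq_from_tnth => i; rewrite !tnth_mktuple lnM ?posrE//; last exact: ts0.
  by rewrite addrC.
rewrite E; rewrite -comp_preimage; congr (P (_ @^-1` A)).
apply/funext => w /=.
by apply: eq_from_tnth => j; rewrite !tnth_mktuple -mulrA.
Qed.

Variable rho : n.-tuple R -> R.
Hypothesis covX : forall t tau, cov X t (tuple_add t tau) = (rho tau)%:E.
Hypothesis rho0 : rho [tuple 0 | _ < n] = 1.
Hypothesis g_gt0 : forall t, orthant R n t -> 0 < g t.

(** The point [tuple_ln t] is [tuple_ln s] translated by the increment of logarithms, so [covX]
    applies; it also provides the finite expectation from which [g s * g t] is pulled out. *)
Lemma lamperti_cov s t : cov Y s t =
  (g s * g t * rho [tuple ln (tnth t i) - ln (tnth s i) | i < n])%:E.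
Proof.
have tE : tuple_ln t = tuple_add (tuple_ln s)
    [tuple ln (tnth t i) - ln (tnth s i) | i < n].
  by apply: eq_from_tnth => i; rewrite !tnth_mktuple subrKC.
have := covX (tuple_ln s) [tuple ln (tnth t i) - ln (tnth s i) | i < n].
rewrite -tE /cov => E.
transitivity ('E_P[(g s * g t) *: (X (tuple_ln s) * X (tuple_ln t))%R])%E.
  by congr expectation; apply/funext => w /=; rewrite /Y /= mulrACA.
by rewrite fin_num_expectationZ E.
Qed.

(** Since [rho] is 1 at the origin, the variances are the squares of the weights; positivity of [g]
    identifies the square root of their product with [g t * g s]. *)
Lemma lamperti_corr s t : orthant R n s -> orthant R n t ->
  corr Y s t = rho [tuple ln (tnth t i) - ln (tnth s i) | i < n].
Proof.
move=> s0 t0; rewrite /corr !lamperti_cov /=.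
have diag u : [tuple ln (tnth u i) - ln (tnth u i) | i < n] =
    [tuple 0 | _ < n] :> n.-tuple R.
  by apply: eq_from_tnth => i; rewrite !tnth_mktuple subrr.
rewrite !diag rho0 !mulr1 -!expr2 -exprMn sqrtr_sqr gtr0_norm ?mulr_gt0 ?g_gt0//.
by rewrite [g t * g s]mulrC mulrAC divff ?mul1r// gt_eqF ?mulr_gt0 ?g_gt0.
Qed.

Lemma lamperti_long_range_dependent (C : R) : (0 < n)%N -> 0 < C ->
  (forall (N : R) (tau : n.-tuple R), (forall i, 0 <= tnth tau i <= N) ->
    C * expR (- (N / 2)) ^+ n <= rho tau) ->
  long_range_dependent Y.
Proof.
move=> n0 C0 rhoC t t0; apply/eqyP => A A0.
have pt0 : 0 < \prod_(i < n) tnth t i by apply: prodr_gt0 => i _; exact: t0.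
set p := \prod_(i < n) tnth t i in pt0.
have q0 : 0 < A / (C * p) by rewrite divr_gt0// mulr_gt0.
(* The second bound makes the final estimate exceed [A]; the first gives [N / 2 >= 1], so that a
   power can be bounded below by its base. *)
have [N N2 AN] : exists2 N : R, 2 <= N & A / (C * p) <= N / 2.
  by exists (2 + 2 * (A / (C * p))); lra.
(* For [tau] in this box, each ln(t_i + tau_i) - ln t_i lies in (0, N]. *)
pose I i : set R := `]0, tnth t i * (expR N - 1)]%classic.
pose B : set (n.-tuple R) := [set x | forall i, I i (tnth x i)].
have mI i : measurable (I i) by exact: measurable_itv.
have eN : 0 < expR N - 1 by rewrite subr_gt0 expR_gt1; lra.
have mB : measurable B.
  rewrite [X in measurable X](_ : _ = \bigcap_(i in [set: 'I_n])
    ((@tnth n R)^~ i @^-1` I i)); last first.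
    by apply/seteqP; split=> x /= h i; [move=> _|]; exact: h.
  apply: fin_bigcap_measurable => // i _.
  by rewrite -[X in measurable X]setTI; exact: measurable_tnth.
have BE : lebesgue_tuple n B = (p * (expR N - 1) ^+ n)%:E.
  rewrite lebesgue_tuple_box//.
  rewrite (eq_bigr (fun i => (tnth t i * (expR N - 1))%:E)); last first.
    move=> i _; rewrite lebesgue_measure_itv/= lte_fin (mulr_gt0 (t0 i) eN).
    by rewrite oppr0 adde0.
  by rewrite prodEFin big_split/= prodr_const card_ord.
have e0 : 0 < C * expR (- (N / 2)) ^+ n.
  by rewrite mulr_gt0// exprn_gt0// expR_gt0.
have BD : B `<=` orthant R n.
  by move=> x xB i; have := xB i; rewrite /I/= in_itv/= => /andP[].
apply: (@le_trans _ _ ((C * expR (- (N / 2)) ^+ n)%:E * lebesgue_tuple n B)%E);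
  last first.
  apply: ge0_integral_ge_cst => // [|x xB]; first exact: ltW.
  have x0 := BD _ xB.
  rewrite lee_fin; apply: le_trans (ler_norm _).
  rewrite lamperti_corr//; last first.
    by move=> i; rewrite tnth_mktuple addr_gt0.
  apply: rhoC => i; rewrite !tnth_mktuple.
  have ti := t0 i; have xi := x0 i.
  rewrite subr_ge0 ler_ln ?posrE ?addr_gt0// lerDl (ltW xi)/=.
  rewrite lerBlDr -[N]expRK -lnM ?posrE ?expR_gt0//.
  rewrite ler_ln ?posrE ?addr_gt0 ?mulr_gt0 ?expR_gt0//.
  have := xB i; rewrite /I/= in_itv/= => /andP[_].
  by rewrite mulrBr mulr1 lerBrDl mulrC.
rewrite BE -EFinM lee_fin.
(* Each factor exp(-N/2) of the lower bound for [rho] is paired with a factor exp(N) - 1 of the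
   volume; their product still grows with [N]. *)
rewrite [leRHS](_ : _ = C * p * (expR (N / 2) - expR (- (N / 2))) ^+ n); last first.
  have NN : - (N / 2) + N = N / 2 by lra.
  rewrite mulrACA -exprMn; congr (_ * _ ^+ _).
  by rewrite mulrBr mulr1 -expRD NN.
have h1 : N / 2 <= expR (N / 2) - expR (- (N / 2)).
  have := expR_ge1Dx (N / 2).
  have : expR (- (N / 2)) <= 1 by rewrite -[leRHS]expR0 ler_expR; lra.
  lra.
rewrite -ler_pdivrMl ?mulr_gt0//.
rewrite mulrC; apply: le_trans AN _.
(* The base is at least [N / 2 >= 1], hence at most its [n]-th power because [n] is positive. *)
apply: (le_trans h1); apply: ler_eXnr => //; lra.
Qed.
End Lamperti.

(** * Exponential lower bounds for the Cauchy covariances *)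

Section CauchyCovariance.
Context (R : realType).
Implicit Types alpha beta x N : R.

(** After inverting and taking the [beta]-th root, the claim becomes 1 + x^alpha <= K exp(x / (2
    beta)), where the left side grows at most quadratically. *)
Lemma cauchy_factor_ge alpha beta : 0 < alpha <= 2 -> 0 < beta ->
  exists2 C : R, 0 < C & forall x, 0 <= x ->
    C * expR (- (x / 2)) <= (1 + x `^ alpha) `^ (- beta).
Proof.
move=> /andP[a0 a2] b0; pose K : R := 2 + 16 * beta ^+ 2.
have K0 : 0 < K by rewrite /K; nra.
exists (K `^ beta)^-1 => [|x x0]; first by rewrite invr_gt0 powR_gt0.
have p0 : 0 < 1 + x `^ alpha by rewrite ltr_wpDr// powR_ge0.
rewrite powRN expRN -invfM lef_pV2 ?posrE ?mulr_gt0 ?powR_gt0 ?expR_gt0//.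
have -> : expR (x / 2) = expR (x / (2 * beta)) `^ beta.
  by rewrite -expRM; congr expR; field; rewrite gt_eqF.
rewrite -powRM ?(ltW K0) ?expR_ge0//.
apply: ge0_ler_powR; rewrite ?nnegrE ?(ltW b0) ?(ltW p0)
  ?mulr_ge0 ?expR_ge0 ?(ltW K0)//.
(* The term 1 covers x <= 1 and the term x^2 covers x >= 1, where alpha <= 2 is used. *)
have xa : x `^ alpha <= 1 + x ^+ 2.
  have [x1|/ltW x1] := leP x 1.
    have : x `^ alpha <= 1 `^ alpha.
      by apply: ge0_ler_powR; rewrite ?nnegrE ?(ltW a0).
    rewrite powR1; nra.
  have := ler_powR x1 a2; rewrite (powR_mulrn 2)//; lra.
(* With this [c] the exponential is the square of exp(c) >= 1 + c. As x = 4 beta c, it remains to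
   see 2 + 16 beta^2 c^2 <= K (1 + c)^2, which explains the value of [K]. *)
set c := x / (4 * beta).
have c0 : 0 <= c by rewrite /c divr_ge0// mulr_ge0// ltW.
have xE : x = 4 * beta * c by rewrite /c mulrC divfK// mulf_neq0 ?pnatr_eq0 ?gt_eqF.
have -> : expR (x / (2 * beta)) = expR c ^+ 2.
  by rewrite -expRM_natl; congr expR; rewrite /c; field; rewrite gt_eqF.
have : (1 + c) ^+ 2 <= expR c ^+ 2.
  by rewrite lerXn2r ?nnegrE ?expR_ge0 ?addr_ge0// expR_ge1Dx.
move=> /(ler_wpM2l (ltW K0)); apply: le_trans.
apply: (@le_trans _ _ (2 + x ^+ 2)); first lra.
rewrite {1}xE /K.
have : 0 <= beta ^+ 2 * c by rewrite mulr_ge0// sqr_ge0.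
have : 0 <= beta ^+ 2 by exact: sqr_ge0.
nra.
Qed.

Lemma cauchy_cov0 n alpha beta : 0 < alpha ->
  cauchy_cov alpha beta [tuple 0 | _ < n] = 1.
Proof.
move=> a0; rewrite /cauchy_cov /enorm big1 => [|i _].
  (* The power 0^alpha is 0 only for nonzero alpha; 0^0 is 1. *)
  by rewrite sqrtr0 powR0 ?gt_eqF// addr0 powR1.
by rewrite tnth_mktuple expr0n.
Qed.

Lemma cauchy_prod_cov0 n (alpha beta : n.-tuple R) :
  (forall i, 0 < tnth alpha i) ->
  cauchy_prod_cov alpha beta [tuple 0 | _ < n] = 1.
Proof.
move=> a0; rewrite /cauchy_prod_cov big1// => i _.
by rewrite tnth_mktuple normr0 powR0 ?gt_eqF// addr0 powR1.
Qed.

(** The factor [n], cruder than its square root, suffices: it turns exp(-x/2) at x = n N into the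
    [n]-th power of exp(-N/2). *)
Lemma enorm_le n (t : n.-tuple R) N : (0 < n)%N ->
  (forall i, 0 <= tnth t i <= N) -> enorm t <= n%:R * N.
Proof.
move=> n0 tN.
(* A coordinate exists as [n] is positive, and it lies between 0 and [N]. *)
have N0 : 0 <= N by have /andP[] := tN (Ordinal n0); exact: le_trans.
have n1 : 1 <= n%:R :> R by rewrite ler1n.
rewrite -[leRHS]ger0_norm ?mulr_ge0// -sqrtr_sqr ler_wsqrtr// exprMn.
apply: (@le_trans _ _ (\sum_(i < n) N ^+ 2)).
  by apply: ler_sum => i _; have /andP[] := tN i; nra.
rewrite sumr_const card_ord -[leLHS]mulr_natl ler_wpM2r ?sqr_ge0//; nra.
Qed.

Lemma cauchy_cov_ge n alpha beta : (0 < n)%N -> 0 < alpha <= 2 -> 0 < beta ->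
  exists2 C : R, 0 < C & forall N (tau : n.-tuple R),
    (forall i, 0 <= tnth tau i <= N) ->
    C * expR (- (N / 2)) ^+ n <= cauchy_cov alpha beta tau.
Proof.
move=> n0 ha hb; have [C C0 hC] := cauchy_factor_ge ha hb.
exists C => // N tau tauN; apply: le_trans (hC _ (sqrtr_ge0 _)).
rewrite ler_wpM2l ?(ltW C0)// -expRM_natl ler_expR.
have := enorm_le n0 tauN; rewrite /enorm; lra.
Qed.

(** The one-dimensional bound holds in each coordinate with its own constant; the constants
    multiply. *)
Lemma cauchy_prod_cov_ge n (alpha beta : n.-tuple R) :
  (forall i, 0 < tnth alpha i <= 2) -> (forall i, 0 < tnth beta i) ->
  exists2 C : R, 0 < C & forall N (tau : n.-tuple R),
    (forall i, 0 <= tnth tau i <= N) ->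
    C * expR (- (N / 2)) ^+ n <= cauchy_prod_cov alpha beta tau.
Proof.
move=> ha hb.
have /choice[C hC] i : exists C : R, 0 < C /\ forall x, 0 <= x ->
    C * expR (- (x / 2)) <= (1 + x `^ tnth alpha i) `^ (- tnth beta i).
  by have [C C0 hC] := cauchy_factor_ge (ha i) (hb i); exists C.
exists (\prod_(i < n) C i) => [|N tau tauN].
  by apply: prodr_gt0 => i _; have [] := hC i.
rewrite -[n in _ ^+ n]card_ord -prodr_const -big_split/=.
apply: ler_prod => i _; have [C0 Ci] := hC i; have /andP[tau0 tN] := tauN i.
rewrite mulr_ge0 ?expR_ge0 ?(ltW C0)//= ger0_norm//.
apply: le_trans (Ci _ tau0); rewrite ler_wpM2l ?(ltW C0)// ler_expR; lra.
Qed.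
End CauchyCovariance.

(** * Homogeneity and positivity of the two weights *)

Section Weights.
Context (R : realType) (n : nat).
Implicit Types (t c H : n.-tuple R) (a : R).

(** This makes self-similarity an instance of the argument for coordinatewise dilations. *)
Lemma tuple_scaleE a t : tuple_scale a t = tuple_mul [tuple a | _ < n] t.
Proof. by apply: eq_from_tnth => i; rewrite !tnth_mktuple. Qed.

Lemma enorm_scale a t : 0 <= a -> enorm (tuple_scale a t) = a * enorm t.
Proof.
move=> a0; rewrite /enorm.
under eq_bigr do rewrite tnth_mktuple exprMn.
by rewrite -mulr_sumr sqrtrM ?sqr_ge0// sqrtr_sqr ger0_norm.
Qed.

Lemma enorm_gt0 t : (0 < n)%N -> orthant R n t -> 0 < enorm t.
Proof.
move=> n0 t0; rewrite sqrtr_gt0 (bigD1 (Ordinal n0))//= ltr_wpDr//.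
  by apply: sumr_ge0 => i _; exact: sqr_ge0.
by rewrite exprn_gt0//; exact: t0.
Qed.

Lemma monomial_mul c t H : orthant R n c -> orthant R n t ->
  monomial (tuple_mul c t) H = monomial c H * monomial t H.
Proof.
move=> c0 t0; rewrite /monomial -big_split/=; apply: eq_bigr => i _.
by rewrite tnth_mktuple powRM ?(ltW (c0 i)) ?(ltW (t0 i)).
Qed.

Lemma monomial_gt0 t H : orthant R n t -> 0 < monomial t H.
Proof. by move=> t0; apply: prodr_gt0 => i _; rewrite powR_gt0//; exact: t0. Qed.
End Weights.

(** * Self-similarity and long range dependence for both weights *)

Section LampertiTransforms.
Context (R : realType) (n : nat) (n_gt0 : (0 < n)%N).
Context (d : measure_display) (T : measurableType d) (P : probability T R).
Variables (rho : n.-tuple R -> R) (X : random_field P n).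
Hypothesis X_stationary : stationary_gaussian_field rho X.
Hypothesis rho0 : rho [tuple 0 | _ < n] = 1.
Hypothesis rho_ge : exists2 C : R, 0 < C & forall (N : R) (tau : n.-tuple R),
  (forall i, 0 <= tnth tau i <= N) -> C * expR (- (N / 2)) ^+ n <= rho tau.

(** The covariance enters only through [rho0] and [rho_ge], so the isotropic and product cases are
    treated together. *)
Lemma norm_lamperti_spec (H : R) (Y := norm_lamperti H X) :
  [/\ gaussian_field (orthant R n) Y, centered (orthant R n) Y,
      self_similar H Y & long_range_dependent Y].
Proof.
have [gX cX sX covX] := X_stationary; have [C C0 rhoC] := rho_ge.
split.
- exact: lamperti_gaussian.
- exact: lamperti_centered.
- move=> a a0.
  have -> : (fun t => Y (tuple_scale a t)) =
      (fun t => Y (tuple_mul [tuple a | _ < n] t)).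
    by apply/funext => t; rewrite tuple_scaleE.
  apply: lamperti_same_fdd => // [i|t t0]; first by rewrite tnth_mktuple.
  by rewrite -tuple_scaleE enorm_scale ?ltW// powRM ?sqrtr_ge0// ltW.
- apply: (lamperti_long_range_dependent covX rho0 _ n_gt0 C0 rhoC) => t t0.
  by rewrite powR_gt0// enorm_gt0.
Qed.

Lemma monomial_lamperti_spec (H : n.-tuple R) (Y := monomial_lamperti H X) :
  [/\ gaussian_field (orthant R n) Y, centered (orthant R n) Y,
      multi_self_similar H Y & long_range_dependent Y].
Proof.
have [gX cX sX covX] := X_stationary; have [C C0 rhoC] := rho_ge.
split.
- exact: lamperti_gaussian.
- exact: lamperti_centered.
- move=> c c0; apply: lamperti_same_fdd => // t t0; exact: monomial_mul.
- apply: (lamperti_long_range_dependent covX rho0 _ n_gt0 C0 rhoC) => t.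
  exact: monomial_gt0.
Qed.
End LampertiTransforms.

Theorem proposition5p5 (R : realType) (n : nat) (n_ge1 : (1 <= n)%N)
    (d : measure_display) (T : measurableType d) (P : probability T R) :
  [/\ forall H alpha beta : R,
        0 < H -> 0 < alpha <= 2 -> 0 < beta ->
        forall X : random_field P n,
          stationary_gaussian_field (cauchy_cov alpha beta) X ->
          let Y := norm_lamperti H X in
          [/\ gaussian_field (orthant R n) Y, centered (orthant R n) Y,
              self_similar H Y & long_range_dependent Y],
      forall (H : R) (alpha beta : n.-tuple R),
        0 < H -> (forall i, 0 < tnth alpha i <= 2) ->
        (forall i, 0 < tnth beta i) ->
        forall X : random_field P n,
          stationary_gaussian_field (cauchy_prod_cov alpha beta) X ->
          let Y := norm_lamperti H X in
          [/\ gaussian_field (orthant R n) Y, centered (orthant R n) Y,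
              self_similar H Y & long_range_dependent Y],
      forall (H : n.-tuple R) (alpha beta : R),
        orthant R n H -> 0 < alpha <= 2 -> 0 < beta ->
        forall X : random_field P n,
          stationary_gaussian_field (cauchy_cov alpha beta) X ->
          let Y := monomial_lamperti H X in
          [/\ gaussian_field (orthant R n) Y, centered (orthant R n) Y,
              multi_self_similar H Y & long_range_dependent Y] &
      forall H alpha beta : n.-tuple R,
        orthant R n H -> (forall i, 0 < tnth alpha i <= 2) ->
        (forall i, 0 < tnth beta i) ->
        forall X : random_field P n,
          stationary_gaussian_field (cauchy_prod_cov alpha beta) X ->
          let Y := monomial_lamperti H X in
          [/\ gaussian_field (orthant R n) Y, centered (orthant R n) Y,
              multi_self_similar H Y & long_range_dependent Y]].
Proof.
split.
- move=> H alpha beta _ a02 b0 X sX; have /andP[a0 _] := a02.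
  by apply: (norm_lamperti_spec n_ge1 sX);
    [exact: cauchy_cov0|exact: cauchy_cov_ge].
- move=> H alpha beta _ a02 b0 X sX.
  have a0 i : 0 < tnth alpha i by have /andP[] := a02 i.
  by apply: (norm_lamperti_spec n_ge1 sX);
    [exact: cauchy_prod_cov0|exact: cauchy_prod_cov_ge].
- move=> H alpha beta _ a02 b0 X sX; have /andP[a0 _] := a02.
  by apply: (monomial_lamperti_spec n_ge1 sX);
    [exact: cauchy_cov0|exact: cauchy_cov_ge].
- move=> H alpha beta _ a02 b0 X sX.
  have a0 i : 0 < tnth alpha i by have /andP[] := a02 i.
  by apply: (monomial_lamperti_spec n_ge1 sX);
    [exact: cauchy_prod_cov0|exact: cauchy_prod_cov_ge].
Qed.
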